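(* Let $R$ be a Prüfer domain with the weak factorization property. Then: (1) each nonzero ideal which is primary to a nonmaximal prime ideal of $R$ is divisorial (in particular, each nonzero nonmaximal prime ideal of $R$ is divisorial); (2) if $M$ is an idempotent maximal ideal of $R$ and $I$ is a nonzero nondivisorial $M$-primary ideal, then $I = I^vM$; (3) each branched idempotent maximal ideal of $R$ is sharp; (4) $R$ has the weak trace property for primary ideals; and (5) each branched nonmaximal prime ideal of $R$ is the radical of a finitely generated ideal.
   Context: For an integral domain $R$ with quotient field $K$ and a nonzero fractional ideal $F$ of $R$, put $F^{-1} = (R:F) = \{x \in K \mid xF \subseteq R\}$ and $F^v = (F^{-1})^{-1}$; a nonzero ideal $F$ is divisorial if $F = F^v$. A Prüfer domain $R$ has the weak factorization property if each nonzero ideal $I$ of $R$ can be written as $I = I^v\Pi$, where $\Pi$ is a finite product of (not necessarily distinct) maximal ideals of $R$ (the empty product being $R$). A prime ideal $P$ is branched if there is a $P$-primary ideal different from $P$. A maximal ideal $M$ of $R$ is sharp if $R_M$ does not contain $\bigcap_{N \neq M} R_N$, where $N$ ranges over the maximal ideals of $R$ different from $M$. The domain $R$ has the weak trace property for primary ideals if, for each nonzero nonmaximal prime ideal $P$ of $R$ and each $P$-primary ideal $Q$, one has $QQ^{-1} = P$. *)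

(* Defs.v *)
From HB Require Import structures.
From mathcomp Require Import all_boot all_order all_algebra.
From mathcomp Require Import boolp classical_sets.

Set Implicit Arguments.
Unset Strict Implicit.
Unset Printing Implicit Defensive.
Import GRing.Theory.
Local Open Scope classical_set_scope.
Local Open Scope ring_scope.

(* Ideals of R are classical sets [set R]; fractional ideals are sets in the  *)
(* quotient field {fraction R}, and I is viewed there through [fracI I].      *)

(* MathComp's [idealr_closed] also demands properness, so the unit ideal      *)
(* would be excluded; see [prime_idealE] for the comparison.                  *)
Definition is_ideal (R : comNzRingType) (I : set R) : Prop :=
  I 0 /\ forall a u v, I u -> I v -> I (a * u + v).

Definition nonzero (R : comNzRingType) (I : set R) : Prop := I <> [set 0].

Definition prime_ideal (R : comNzRingType) (P : set R) : Prop :=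
  [/\ is_ideal P, ~ P 1 & forall u v, P (u * v) -> P u \/ P v].

Definition maximal_ideal (R : comNzRingType) (M : set R) : Prop :=
  [/\ is_ideal M, ~ M 1 &
      forall J, is_ideal J -> M `<=` J -> J = M \/ J = setT].

Definition radical (R : comNzRingType) (I : set R) : set R :=
  [set x | exists n, I (x ^+ n)].

Definition primary_ideal (R : comNzRingType) (Q : set R) : Prop :=
  [/\ is_ideal Q, ~ Q 1 & forall x y, Q (x * y) -> Q x \/ exists n, Q (y ^+ n)].

Definition primary_to (R : comNzRingType) (P Q : set R) : Prop :=
  primary_ideal Q /\ radical Q = P.

Definition gen_ideal (R : comNzRingType) (s : seq R) : set R :=
  [set x | exists c : 'I_(size s) -> R, x = \sum_i c i * s`_i].

Definition fin_gen (R : comNzRingType) (I : set R) : Prop :=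
  exists s, I = gen_ideal s.

(* Used both for ideals of R and for R-submodules of {fraction R}.            *)
Definition mulI (A : comNzRingType) (X Y : set A) : set A :=
  [set z | exists n (x y : 'I_n -> A),
    (forall i, X (x i) /\ Y (y i)) /\ z = \sum_i x i * y i].

Definition idempotent_ideal (R : comNzRingType) (I : set R) : Prop :=
  mulI I I = I.

Definition branched (R : comNzRingType) (P : set R) : Prop :=
  exists Q, primary_to P Q /\ Q <> P.

Definition fracI (R : idomainType) (I : set R) : set {fraction R} :=
  @tofrac R @` I.

Definition invI (R : idomainType) (F : set {fraction R}) : set {fraction R} :=
  [set x | forall y, F y -> range (@tofrac R) (x * y)].

Definition vI (R : idomainType) (F : set {fraction R}) : set {fraction R} :=
  invI (invI F).

Definition divisorial (R : idomainType) (I : set R) : Prop :=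
  fracI I = vI (fracI I).

Definition invertible_ideal (R : idomainType) (I : set R) : Prop :=
  mulI (fracI I) (invI (fracI I)) = fracI setT.

Definition prufer (R : idomainType) : Prop :=
  forall I : set R, is_ideal I -> nonzero I -> fin_gen I -> invertible_ideal I.

Definition weak_factorization (R : idomainType) : Prop :=
  forall I : set R, is_ideal I -> nonzero I ->
    exists n (M : 'I_n -> set R), (forall i, maximal_ideal (M i)) /\
      fracI I = mulI (vI (fracI I)) (fracI (\big[@mulI R/setT]_(i < n) M i)).

Definition localize (R : idomainType) (P : set R) : set {fraction R} :=
  [set x | exists a s, ~ P s /\ x = tofrac a / tofrac s].

(* If R is local the intersection is empty, hence the whole quotient field.   *)
Definition sharp (R : idomainType) (M : set R) : Prop :=
  ~ (\bigcap_(N in [set N | maximal_ideal N /\ N <> M]) localize N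
       `<=` localize M).

Definition weak_trace_primary (R : idomainType) : Prop :=
  forall P Q : set R, prime_ideal P -> nonzero P -> ~ maximal_ideal P ->
    primary_to P Q -> mulI (fracI Q) (invI (fracI Q)) = fracI P.

Lemma prime_idealE (R : comNzRingType) (P : set R) :
  prime_ideal P <-> idealr_closed (mem P) /\ prime_idealr_closed (mem P).
Proof.
have memP x : (x \in mem P) = (x \in P) by [].
split=> [[[P0 PD] P1 PM]|[[P0 P1 PD] PM]].
  split; first split.
  - by rewrite memP; apply/mem_set.
  - by rewrite memP; apply/negP => /set_mem.
  - move=> a u v; rewrite !memP => /set_mem Pu /set_mem Pv.
    by apply/mem_set/PD.
  move=> u v; rewrite !memP => /set_mem /PM [] H; apply/orP; [left|right];
    exact/mem_set.
move: P0 P1; rewrite !memP => P0 P1; split.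
- split=> [|a u v Pu Pv]; first exact: set_mem.
  by apply: set_mem; rewrite -memP; apply: PD; rewrite memP; apply: mem_set.
- by move=> /mem_set H; move: P1; rewrite H.
- move=> u v /mem_set; rewrite -memP => /PM; rewrite !memP.
  by move=> /orP [] /set_mem; [left|right].
Qed.

(* Main.v *)
Require Import Defs.
From HB Require Import structures.
From mathcomp Require Import all_boot all_order all_algebra.
From mathcomp Require Import boolp classical_sets.
From mathcomp Require Import ring.

Set Implicit Arguments.
Unset Strict Implicit.
Unset Printing Implicit Defensive.
Import GRing.Theory.
Local Open Scope classical_set_scope.
Local Open Scope ring_scope.

(** Write I = I^v M_1 ... M_n for a nonzero ideal I.  The inclusion of the
    product in I is what drives every part.

    If I is primary to a prime P that is none of the M_i, pick in the product
    an element s outside P; then I^v s is inside I, and s may be cancelled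
    because I is P-primary, so I = I^v.  This settles (1), where P is not
    maximal at all.  If I is primary to an idempotent maximal ideal M, the
    factors M_i <> M cancel in the same way and the powers of M collapse, so
    that I^v M is inside I ([idempotent_absorb]).  For (2) it remains that M
    does occur among the M_i when I is not divisorial.  For (3), if M is not
    sharp and Q is M-primary, then Q^-1 lies in R_N for every maximal N <> M,
    hence in R_M too, hence in R; so Q^v = R, M = Q^v M is inside Q, and M is
    not branched.

    For (4), J = Q Q^-1 is an ideal inside P ([primary_trace_sub]), by
    comparing elements in the valuation rings R_M.  Since Q is divisorial,
    an x in J^-1 multiplies Q into itself; checking at each maximal ideal, such
    an x also multiplies P into R ([primary_stabilizer]), so P is inside J^v.
    The maximal ideals in the factorization of J contain J, hence Q, hence P,
    and multiplying P by a maximal ideal properly above it changes nothing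
    ([prime_mul_maximal]).  So P is inside J^v M_1 ... M_n = J.

    For (5), let Q <> P be P-primary.  As Q Q^-1 = P is not inside Q, some y
    in Q^-1 satisfies y Q not inside Q.  The conductor of y into R contains Q,
    is inside P because Q is P-primary, and is finitely generated because R is
    Prufer ([prufer_conductor]); so its radical is P.

    Invertibility of ideals with two generators enters only through
    [prufer_arithmetical], an identity between elements of R which makes the
    localizations at maximal ideals valuation rings. *)

Local Notation "x %:F" := (tofrac x).

(** * Ideals and their products *)

Lemma idealD (R : comNzRingType) (I : set R) u v :
  is_ideal I -> I u -> I v -> I (u + v).
Proof. by move=> [_ ID] Iu Iv; rewrite -[u]mul1r; apply: ID. Qed.

Lemma idealMl (R : comNzRingType) (I : set R) a u :
  is_ideal I -> I u -> I (a * u).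
Proof. by move=> [I0 ID] Iu; rewrite -[_ * _]addr0; apply: ID. Qed.

Lemma idealMr (R : comNzRingType) (I : set R) a u :
  is_ideal I -> I u -> I (u * a).
Proof. by rewrite mulrC; apply: idealMl. Qed.

Lemma ideal_one (R : comNzRingType) (I : set R) x :
  is_ideal I -> I x -> I (1 - x) -> I 1.
Proof. by move=> hI Ix /(idealD hI Ix); rewrite addrC subrK. Qed.

Lemma nonzeroP (R : comNzRingType) (I : set R) :
  is_ideal I -> nonzero I -> exists2 x, I x & x <> 0.
Proof.
move=> [I0 _] nz; apply: contrapT => no; apply: nz.
apply/seteqP; split=> x /=; last by move=> ->.
by move=> Ix; apply: contrapT => x0; apply: no; exists x.
Qed.

Lemma prime_exp (R : comNzRingType) (P : set R) x n :
  prime_ideal P -> P (x ^+ n) -> P x.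
Proof.
move=> [_ P1 PM]; elim: n => [|n IH]; first by rewrite expr0.
by rewrite exprS => /PM [].
Qed.

Lemma prime_radical (R : comNzRingType) (P : set R) :
  prime_ideal P -> radical P = P.
Proof.
move=> hP; apply/seteqP; split=> x /=; first by move=> [n]; exact: prime_exp.
by move=> Px; exists 1%N; rewrite expr1.
Qed.

Lemma prime_primary (R : comNzRingType) (P : set R) :
  prime_ideal P -> primary_to P P.
Proof.
move=> hP; split; last exact: prime_radical.
case: hP => [PI P1 PM]; split=> // x y /PM [|Py]; [by left|right].
by exists 1%N; rewrite expr1.
Qed.

Lemma primary_sub (R : comNzRingType) (P Q : set R) :
  primary_to P Q -> Q `<=` P.
Proof. by move=> [_ <-] x Qx; exists 1%N; rewrite expr1. Qed.

Lemma primary_to_cancel (R : comNzRingType) (P Q : set R) x y :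
  primary_to P Q -> Q (x * y) -> ~ P y -> Q x.
Proof. by move=> [[_ _ QM] <-] /QM []. Qed.

(** So, over a domain, an ideal with nonzero radical is nonzero. *)
Lemma radical0 (R : idomainType) : radical [set 0 : R] = [set 0].
Proof.
apply/seteqP; split=> x /=; last by move=> ->; exists 1%N; rewrite expr1.
by move=> [n /eqP]; rewrite expf_eq0 => /andP [_ /eqP].
Qed.

Lemma mulIM (A : comNzRingType) (X Y : set A) x y :
  X x -> Y y -> mulI X Y (x * y).
Proof.
move=> Xx Yy; exists 1%N, (fun=> x), (fun=> y); split=> //.
by rewrite big_ord1.
Qed.

Lemma mulI0 (A : comNzRingType) (X Y : set A) : mulI X Y 0.
Proof.
by exists 0%N, (fun=> 0), (fun=> 0); split; [case | rewrite big_ord0].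
Qed.

Lemma mulID (A : comNzRingType) (X Y : set A) u v :
  mulI X Y u -> mulI X Y v -> mulI X Y (u + v).
Proof.
move=> [n [x [y [xy ->]]]] [m [x' [y' [xy' ->]]]].
pose j (a : 'I_n -> A) (b : 'I_m -> A) (i : 'I_(n + m)) :=
  match split i with inl k => a k | inr k => b k end.
exists (n + m)%N, (j x x'), (j y y'); split.
  by move=> i; rewrite /j; case: (split i).
rewrite big_split_ord; congr (_ + _); apply: eq_bigr => i _; rewrite /j.
  by rewrite (unsplitK (inl i : 'I_n + 'I_m)).
by rewrite (unsplitK (inr i : 'I_n + 'I_m)).
Qed.

(** How an inclusion of a product is checked: on the products x y alone, as soon
    as the target is closed under addition. *)
Lemma mulI_ind (A : comNzRingType) (X Y Z : set A) :
  Z 0 -> (forall u v, Z u -> Z v -> Z (u + v)) ->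
  (forall x y, X x -> Y y -> Z (x * y)) -> mulI X Y `<=` Z.
Proof.
move=> Z0 ZD ZM _ [n [x [y [xy ->]]]]; apply: big_ind => // i _.
by case: (xy i) => *; apply: ZM.
Qed.

Lemma mulI_subideal (R : comNzRingType) (X Y Z : set R) : is_ideal Z ->
  (forall x y, X x -> Y y -> Z (x * y)) -> mulI X Y `<=` Z.
Proof.
by move=> hZ; apply: mulI_ind => [|u v]; [case: hZ | exact: idealD].
Qed.

Lemma mulI_mono (A : comNzRingType) (X X' Y Y' : set A) :
  X `<=` X' -> Y `<=` Y' -> mulI X Y `<=` mulI X' Y'.
Proof.
move=> XX YY; apply: mulI_ind => [|u v|x y Xx Yy]; first exact: mulI0.
  exact: mulID.
by apply: mulIM; [apply: XX | apply: YY].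
Qed.

Lemma mulI_scale (A : comNzRingType) (X Y : set A) a :
  (forall x, X x -> X (a * x)) -> forall z, mulI X Y z -> mulI X Y (a * z).
Proof.
move=> Xa; apply: mulI_ind => [|u v Zu Zv|x y Xx Yy].
- by rewrite mulr0; apply: mulI0.
- by rewrite mulrDr; apply: mulID.
- by rewrite mulrA; apply: mulIM => //; apply: Xa.
Qed.

Lemma mulI_ideal (R : comNzRingType) (X Y : set R) :
  is_ideal X -> is_ideal (mulI X Y).
Proof.
move=> hX; split; first exact: mulI0.
move=> a u v Zu Zv; apply: mulID => //; apply: mulI_scale Zu => x.
exact: idealMl.
Qed.

(** * Maximal ideals *)

(** Zorn's lemma is applied to the sets A whose union with I is a proper ideal,
    rather than to the proper ideals above I: the union of the empty chain is
    then a legitimate candidate. *)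
Lemma maximal_exists (R : comNzRingType) (I : set R) :
  is_ideal I -> ~ I 1 -> exists2 M, maximal_ideal M & I `<=` M.
Proof.
move=> hI I1; pose T (A : set R) := is_ideal (I `|` A) /\ ~ (I `|` A) 1.
have [|A [[hA A1] Amax]] := @Zorn_bigcup _ T.
  move=> F FT Ftot; have I0 : I 0 by case: hI.
  split; last first.
    by move=> [//|[X FX X1]]; case: (FT _ FX) => _; apply; right.
  split; first by left.
  have big X a u v : F X -> (I `|` X) u -> (I `|` X) v ->
      (I `|` \bigcup_(X in F) X) (a * u + v).
    move=> FX uX vX; have [[_ /(_ a u v uX vX) H] _] := FT _ FX.
    by case: H => [|H]; [left | right; exists X].
  move=> a u v [Iu|[X FX Xu]] [Iv|[Y FY Yv]].
  - by left; case: hI => _; apply.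
  - by apply: (big Y) => //; [left|right].
  - by apply: (big X) => //; [right|left].
  - case: (Ftot _ _ FX FY) => XY.
      by apply: (big Y) => //; [right; apply: XY | right].
    by apply: (big X) => //; [right | right; apply: XY].
exists (I `|` A); last by move=> x; left.
split=> // J hJ AJ; have [J1|J1] := EM (J 1).
  right; apply/seteqP; split=> // x _; rewrite -[x]mulr1; exact: idealMl.
left; apply/seteqP; split=> // x Jx; apply: contrapT => nx.
have IJ : I `|` J = J by apply/setUidPr => y Iy; apply: AJ; left.
apply: (Amax J); last by rewrite /T IJ.
split=> [y Ay|JA]; first by apply: AJ; right.
by apply: nx; right; apply: JA.
Qed.

Lemma ideal_adjoin (R : comNzRingType) (M : set R) x :
  is_ideal M -> is_ideal [set z | exists a m, M m /\ z = a * x + m].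
Proof.
move=> hM; split; first by exists 0, 0; split; [case: hM | ring].
move=> c _ _ [a [m [Mm ->]]] [a' [m' [Mm' ->]]].
by exists (c * a + a'), (c * m + m'); split; [case: hM => _; apply | ring].
Qed.

Lemma maximal_comax (R : comNzRingType) (M : set R) x :
  maximal_ideal M -> ~ M x -> exists a m, M m /\ 1 = a * x + m.
Proof.
move=> [hM M1 Mmax] nMx.
have [|E|E] := Mmax _ (ideal_adjoin x hM).
- by move=> y My; exists 0, y; split=> //; ring.
- case: nMx; rewrite -E; exists 1, 0; split; [by case: hM | ring].
- by have : (setT : set R) 1 by []; rewrite -E.
Qed.

Lemma maximal_prime (R : comNzRingType) (M : set R) :
  maximal_ideal M -> prime_ideal M.
Proof.
move=> hM; case: (hM) => hMI M1 _; split=> // u v Muv.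
have [|nMu] := EM (M u); [by left | right].
have [a [m [Mm E]]] := maximal_comax hM nMu.
have -> : v = a * (u * v) + v * m by rewrite -[v in LHS]mul1r E; ring.
by apply: idealD => //; apply: idealMl.
Qed.

Lemma maximal_notin (R : comNzRingType) (P M : set R) :
  maximal_ideal M -> is_ideal P -> ~ P 1 -> P <> M -> exists2 m, M m & ~ P m.
Proof.
move=> [_ _ Mmax] hP P1 PM; apply: contrapT => no.
have MP : M `<=` P.
  by move=> m Mm; apply: contrapT => nPm; apply: no; exists m.
by have [//|PT] := Mmax P hP MP; apply: P1; rewrite PT.
Qed.

(** * Products of maximal ideals *)

Local Notation maxprod n M := (\big[@mulI _ / setT]_(i < n) M i).

Lemma maxprod_sub (R : comNzRingType) n (M : 'I_n -> set R) :
  (forall i, maximal_ideal (M i)) -> forall i, maxprod n M `<=` M i.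
Proof.
elim: n M => [|n IH] M hM i; first by case: i.
rewrite big_ord_recl; apply: mulI_subideal => [|x y Mx Py].
  by case: (hM i).
case: (unliftP ord0 i) => [j ->|->].
  apply: idealMl; first by case: (hM (lift ord0 j)).
  exact: IH Py.
by apply: idealMr => //; case: (hM ord0).
Qed.

(** Each factor M_i, being maximal and different from P, has an element outside
    P, and P is prime. *)
Lemma maxprod_notin (R : comNzRingType) (P : set R) n (M : 'I_n -> set R) :
  prime_ideal P -> (forall i, maximal_ideal (M i)) -> (forall i, P <> M i) ->
  exists2 s, maxprod n M s & ~ P s.
Proof.
move=> [hP P1 PM]; elim: n M => [|n IH] M hM PnM.
  by rewrite big_ord0; exists 1.
rewrite big_ord_recl.
have [m Mm nPm] := maximal_notin (hM ord0) hP P1 (PnM ord0).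
have [s Ss nPs] := IH (fun i => M (lift ord0 i)) (fun=> hM _) (fun=> PnM _).
by exists (m * s); [exact: mulIM | move=> /PM []].
Qed.

(** The factors different from M are cancelled one by one, as I is M-primary;
    those equal to M are absorbed by M = M M.  If no factor is M the conclusion
    still holds, since then x is already in I. *)
Lemma maxprod_idempotent (R : comNzRingType) (M I : set R) n
    (N : 'I_n -> set R) x :
  maximal_ideal M -> idempotent_ideal M -> primary_to M I ->
  (forall i, maximal_ideal (N i)) ->
  (forall s, maxprod n N s -> I (x * s)) -> forall m, M m -> I (x * m).
Proof.
move=> hM MM hI; have [[II _ _] _] := hI.
elim: n N x => [|n IH] N x hN.
  rewrite big_ord0 => H m _; apply: idealMr => //.
  by rewrite -[x]mulr1; apply: H.
rewrite big_ord_recl => H.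
have step m0 : N ord0 m0 -> forall m, M m -> I (x * m0 * m).
  move=> Nm0; apply: (IH (fun i => N (lift ord0 i))) => // s Ss.
  by rewrite -mulrA; apply: H; apply: mulIM.
have [E|ne] := EM (M = N ord0); last first.
  have [hMI M1 _] := hM.
  have [s Ns nMs] := maximal_notin (hN ord0) hMI M1 ne.
  move=> m Mm; apply: (primary_to_cancel hI _ nMs).
  by rewrite mulrAC; apply: step.
move=> m; rewrite -MM; move: m.
have xI : is_ideal [set m | I (x * m)].
  split=> /=; first by rewrite mulr0; case: II.
  move=> a u v Iu Iv; rewrite mulrDr mulrCA.
  by case: II => _; apply.
apply: (mulI_subideal xI) => a b Ma Mb /=.
by rewrite mulrA; apply: step => //; rewrite -E.
Qed.

(** * Fractional ideals *)

Lemma fracP (R : idomainType) (x : {fraction R}) :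
  exists a b : R, b != 0 /\ x = a%:F / b%:F.
Proof.
elim/quotW: x => y; exists (\n_y), (\d_y); split; first exact: denom_ratioP.
apply: (canRL (mulfK _)); first by rewrite tofrac_eq0 denom_ratioP.
unlock tofrac; rewrite -[LHS]FracField.pi_mul; apply/eqmodP.
rewrite /= FracField.equivfE /FracField.mulf.
by rewrite !numden_Ratio ?mulr1 ?oner_neq0 ?denom_ratioP // mulrC.
Qed.

Lemma range_tofrac_ideal (R : idomainType) (x : {fraction R}) :
  is_ideal [set t | range (@tofrac R) (x * t%:F)].
Proof.
split; first by exists 0 => //; rewrite tofrac0 mulr0.
move=> a u v [c _ cE] [d _ dE]; exists (a * c + d) => //.
by rewrite tofracD tofracM cE dE tofracD tofracM; ring.
Qed.

(** A domain is the intersection of its localizations at maximal ideals: the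
    denominators of x form an ideal that no maximal ideal contains. *)
Lemma range_tofrac_local (R : idomainType) (x : {fraction R}) :
  (forall N, maximal_ideal N ->
     exists2 t, ~ N t & range (@tofrac R) (x * t%:F)) ->
  range (@tofrac R) x.
Proof.
move=> loc; apply: contrapT => nx.
have [|N hN xN] := maximal_exists (range_tofrac_ideal x).
  by rewrite /= tofrac1 mulr1.
by have [t nNt xt] := loc N hN; apply/nNt/xN.
Qed.

Lemma range_tofracM (R : idomainType) (x : {fraction R}) a :
  range (@tofrac R) x -> range (@tofrac R) (x * a%:F).
Proof. by move=> [c _ <-]; exists (c * a) => //; rewrite tofracM. Qed.

Lemma fracIE (R : idomainType) (I : set R) r : fracI I r%:F -> I r.
Proof. by move=> [s Is /eqP]; rewrite tofrac_eq => /eqP <-. Qed.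

Lemma fracI_in (R : idomainType) (I : set R) r : I r -> fracI I r%:F.
Proof. by move=> Ir; exists r. Qed.

Lemma fracI_add (R : idomainType) (I : set R) u v :
  is_ideal I -> fracI I u -> fracI I v -> fracI I (u + v).
Proof.
move=> hI [a Ia <-] [b Ib <-]; exists (a + b); last by rewrite tofracD.
exact: idealD.
Qed.

Lemma fracI0 (R : idomainType) (I : set R) : is_ideal I -> fracI I 0.
Proof. by move=> [I0 _]; exists 0 => //; rewrite tofrac0. Qed.

Lemma invI_fracI1 (R : idomainType) (I : set R) : invI (fracI I) 1.
Proof. by move=> _ [a _ <-]; rewrite mul1r; exists a. Qed.

Lemma sub_vI (R : idomainType) (F : set {fraction R}) : F `<=` vI F.
Proof. by move=> x Fx y /(_ x Fx); rewrite mulrC. Qed.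

Lemma vI_range (R : idomainType) (I : set R) x :
  vI (fracI I) x -> range (@tofrac R) x.
Proof. by move=> /(_ 1 (@invI_fracI1 _ I)); rewrite mulr1. Qed.

Lemma divisorialP (R : idomainType) (I : set R) :
  (forall r, vI (fracI I) r%:F -> I r) -> divisorial I.
Proof.
move=> H; apply/seteqP; split; first exact: sub_vI.
move=> x vx; have [r _ rE] := vI_range vx.
by exists r => //; apply: H; rewrite rE.
Qed.

Lemma weak_factorization_mem (R : idomainType) (I X : set R) r s :
  fracI I = mulI (vI (fracI I)) (fracI X) ->
  vI (fracI I) r%:F -> X s -> I (r * s).
Proof.
move=> E vr Xs; apply: fracIE; rewrite E tofracM.
by apply: mulIM => //; apply: fracI_in.
Qed.

(** * Divisoriality and sharpness *)

(** A nonmaximal P is none of the maximal factors, so their product has an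
    element s outside P, which can be cancelled from Q^v s inside Q. *)
Lemma weak_factorization_divisorial (R : idomainType) (P Q : set R) :
  weak_factorization R -> prime_ideal P -> ~ maximal_ideal P ->
  primary_to P Q -> nonzero Q -> divisorial Q.
Proof.
move=> hW hP nmP hQ nzQ; have [[QI _ _] _] := hQ.
have [n [M [hM E]]] := hW Q QI nzQ.
have [i PM|s Ms nPs] := maxprod_notin hP hM; first by apply: nmP; rewrite PM.
apply: divisorialP => r vr.
exact: primary_to_cancel hQ (weak_factorization_mem E vr Ms) nPs.
Qed.

Lemma idempotent_absorb (R : idomainType) (M I : set R) :
  weak_factorization R -> maximal_ideal M -> idempotent_ideal M ->
  primary_to M I -> nonzero I ->
  forall r m, vI (fracI I) r%:F -> M m -> I (r * m).
Proof.
move=> hW hM MM hI nzI r m vr; have [[II _ _] _] := hI.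
have [n [N [hN E]]] := hW I II nzI; move: m.
apply: (maxprod_idempotent hM MM hI hN) => s.
exact: weak_factorization_mem E vr.
Qed.

(** If M were none of the factors, an element of their product outside M could
    be cancelled, making I divisorial. *)
Lemma weak_factorization_idempotent (R : idomainType) (M I : set R) :
  weak_factorization R -> maximal_ideal M -> idempotent_ideal M ->
  primary_to M I -> nonzero I -> ~ divisorial I ->
  fracI I = mulI (vI (fracI I)) (fracI M).
Proof.
move=> hW hM MM hI nzI ndI; have [[II _ _] _] := hI.
apply/seteqP; split; last first.
  apply: mulI_ind => [|u v|x _ vx [m Mm <-]]; first exact: fracI0.
    exact: fracI_add.
  have [r _ rE] := vI_range vx; rewrite -rE in vx *; rewrite -tofracM.
  by apply: fracI_in; apply: (idempotent_absorb hW hM MM hI).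
have [n [N [hN E]]] := hW I II nzI.
have [i NM] : exists i, M = N i.
  apply: contrapT => no; apply: ndI.
  have [i MN|s Ns nMs] := maxprod_notin (maximal_prime hM) hN.
    by apply: no; exists i.
  apply: divisorialP => r vr.
  exact: primary_to_cancel hI (weak_factorization_mem E vr Ns) nMs.
rewrite {1}E; apply: mulI_mono => // _ [s Ns <-].
by apply: fracI_in; rewrite NM; apply: maxprod_sub Ns.
Qed.

(** Q is not inside N, since its radical M is not, and an element of Q outside N
    is a denominator for every element of Q^-1. *)
Lemma primary_invI_localize (R : idomainType) (M N Q : set R) :
  maximal_ideal M -> maximal_ideal N -> N <> M -> primary_to M Q ->
  invI (fracI Q) `<=` localize N.
Proof.
move=> hM hN NM [_ radQ] x Qx.
have [hNI N1 _] := hN.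
have [m Mm nNm] := maximal_notin hM hNI N1 NM.
have [k Qk] : radical Q m by rewrite radQ.
have nNk : ~ N (m ^+ k) by move=> /(prime_exp (maximal_prime hN)).
have [a _ aE] := Qx _ (fracI_in Qk).
exists a, (m ^+ k); split=> //; rewrite aE mulfK // tofrac_eq0.
by apply: contra_notN nNk => /eqP ->; case: hNI.
Qed.

Lemma localize_denom (R : idomainType) (P : set R) x : is_ideal P ->
  localize P x -> exists2 t, ~ P t & range (@tofrac R) (x * t%:F).
Proof.
move=> [P0 _] [a [s [nPs ->]]]; exists s => //; exists a => //.
by rewrite divfK // tofrac_eq0; apply: contra_notN nPs => /eqP ->.
Qed.

(** If M is not sharp, every M-primary Q has Q^v = R: the elements of Q^-1 are
    in R_N for each N <> M, thus in R_M, thus in R.  Absorption then forces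
    Q = M. *)
Lemma branched_idempotent_sharp (R : idomainType) (M : set R) :
  weak_factorization R -> maximal_ideal M -> branched M ->
  idempotent_ideal M -> sharp M.
Proof.
move=> hW hM [Q [hQ QM]] MM nonsharp; apply: (QM).
have [[QI Q1 _] radQ] := hQ.
have nzQ : nonzero Q.
  by move=> Q0; apply: QM; rewrite -radQ Q0 radical0.
have v1 : vI (fracI Q) (1 : R)%:F.
  move=> x Qx; rewrite tofrac1 mul1r; apply: range_tofrac_local => N hN.
  apply: localize_denom; first by case: hN.
  have [->|NM] := EM (N = M).
    apply: nonsharp => L [hL LM].
    exact: (primary_invI_localize hM hL LM hQ Qx).
  exact: (primary_invI_localize hM hN NM hQ Qx).
apply/seteqP; split; first exact: primary_sub hQ.
by move=> m Mm; rewrite -[m]mul1r; apply: (idempotent_absorb hW hM MM hQ).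
Qed.

(** * Arithmetic of Prufer domains *)

Lemma gen_ideal2 (R : comNzRingType) (a b : R) :
  gen_ideal [:: a; b] = [set x | exists c d, x = c * a + d * b].
Proof.
apply/seteqP; split=> x /=.
  move=> [c ->]; exists (c ord0), (c (lift ord0 ord0)).
  by rewrite big_ord_recl big_ord1.
move=> [c [d ->]]; exists (fun i : 'I_2 => if i == ord0 then c else d).
by rewrite big_ord_recl big_ord1.
Qed.

(** From 1 = a u + b v with u, v in (a, b)^-1, take al = a u, ga = b u and
    be = a v.  Since al and 1 - al are comaximal, at any prime one of them is a
    unit, and a and b become comparable there. *)
Lemma prufer_arithmetical (R : idomainType) (a b : R) : prufer R ->
  exists al be ga, a * ga = b * al /\ a * (1 - al) = b * be.
Proof.
move=> hP; have [[-> ->]|ab] := EM (a = 0 /\ b = 0).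
  by exists 0, 0, 0; rewrite !mul0r.
pose I := gen_ideal [:: a; b].
have IE : I = [set x | exists c d, x = c * a + d * b] := gen_ideal2 a b.
have Ia : I a by rewrite IE; exists 1, 0; ring.
have Ib : I b by rewrite IE; exists 0, 1; ring.
have hI : is_ideal I.
  rewrite IE; split; first by exists 0, 0; ring.
  move=> c _ _ [x [y ->]] [x' [y' ->]].
  by exists (c * x + x'), (c * y + y'); ring.
have nzI : nonzero I.
  by move=> I0; apply: ab; split; move: Ia Ib; rewrite I0.
have inv := hP I hI nzI (ex_intro _ [:: a; b] erefl).
pose Z : set {fraction R} := [set z | exists u v, [/\ invI (fracI I) u,
  invI (fracI I) v & z = a%:F * u + b%:F * v]].
have : mulI (fracI I) (invI (fracI I)) `<=` Z.
  have invD x y c d : invI (fracI I) x -> invI (fracI I) y ->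
      invI (fracI I) (c%:F * x + d%:F * y).
    move=> hx hy z Iz; have [r _ rE] := hx z Iz; have [s _ sE] := hy z Iz.
    exists (c * r + d * s) => //.
    by rewrite tofracD !tofracM rE sE; ring.
  apply: mulI_ind => [|z z' [u [v [hu hv ->]]] [u' [v' [hu' hv' ->]]]|].
  - exists 0, 0; split; [| |ring] => x _; rewrite mul0r;
      by exists 0; rewrite ?tofrac0.
  - exists (u + u'), (v + v'); split; last ring.
      by have := invD _ _ 1 1 hu hu'; rewrite tofrac1 !mul1r.
    by have := invD _ _ 1 1 hv hv'; rewrite tofrac1 !mul1r.
  - move=> _ y [x Ix <-] hy; move: Ix; rewrite IE => -[c [d ->]].
    exists (c%:F * y), (d%:F * y); split.
    + by have := invD _ _ c 0 hy hy; rewrite tofrac0 mul0r addr0.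
    + by have := invD _ _ d 0 hy hy; rewrite tofrac0 mul0r addr0.
    + by rewrite tofracD !tofracM; ring.
rewrite inv => /(_ 1) [|u [v [hu hv E]]]; first by exists 1; rewrite ?tofrac1.
have [al _ alE] := hu _ (fracI_in Ia); have [ga _ gaE] := hu _ (fracI_in Ib).
have [be _ beE] := hv _ (fracI_in Ia); have [de _ deE] := hv _ (fracI_in Ib).
exists al, be, ga; split; apply/eqP; rewrite -tofrac_eq; apply/eqP.
  by rewrite !tofracM alE gaE; ring.
by rewrite !tofracM tofracB alE beE tofrac1 E; ring.
Qed.

(** R_N is a valuation ring. *)
Lemma prufer_compare (R : idomainType) (N : set R) (a b : R) :
  prufer R -> prime_ideal N ->
  exists t c, ~ N t /\ (t * a = b * c \/ t * b = a * c).
Proof.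
move=> hR [NI N1 _]; have [al [be [ga [E1 E2]]]] := prufer_arithmetical a b hR.
have [Nal|nNal] := EM (N al); last first.
  by exists al, ga; split=> //; right; rewrite mulrC.
exists (1 - al), be; split; last by left; rewrite mulrC.
by move=> /(ideal_one NI Nal).
Qed.

(** For x = a / b with b <> 0 the conductor is b (a, b)^-1, which is invertible;
    if 1 = a u + b v with u, v in (a, b)^-1, its generators are b u = ga and
    b v = 1 - al. *)
Lemma prufer_conductor (R : idomainType) (x : {fraction R}) : prufer R ->
  fin_gen [set r | range (@tofrac R) (x * r%:F)].
Proof.
move=> hR; have [a [b [b0 xE]]] := fracP x.
have bF : b%:F != 0 by rewrite tofrac_eq0.
have [al [be [ga [E1 E2]]]] := prufer_arithmetical a b hR.
have rangeE r : range (@tofrac R) (x * r%:F) <-> exists c, a * r = b * c.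
  rewrite xE mulrAC -tofracM; split=> [[c _ cE]|[c ->]]; exists c => //.
    apply/eqP; rewrite -tofrac_eq; apply/eqP.
    by rewrite [RHS]tofracM cE [RHS]mulrC divfK.
  by rewrite tofracM mulrC mulKf.
exists [:: ga; 1 - al]; rewrite gen_ideal2; apply/seteqP; split=> r /=.
  move=> /rangeE [c E]; exists c, r.
  suff -> : c * ga = r * al by ring.
  by apply: (mulfI b0); rewrite mulrA -E mulrAC E1; ring.
move=> [c [d ->]]; apply/rangeE; exists (c * al + d * be).
by rewrite mulrDr !(mulrCA a) E1 E2; ring.
Qed.

(** * The trace of a primary ideal *)

(** For a maximal M above P, the extension of Q to R_M is a module over R_P, and
    so is its multiple by y, which lies in R_M; but no R_P-submodule of R_M
    contains an element outside P R_P. *)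
Lemma primary_trace_sub (R : idomainType) (P Q : set R) q y :
  prufer R -> prime_ideal P -> ~ maximal_ideal P -> primary_to P Q ->
  Q q -> invI (fracI Q) y -> fracI P (q%:F * y).
Proof.
move=> hR hP nmP hQ Qq hy; have [PI P1 PM] := hP; have [[QI _ _] _] := hQ.
have [u _ uE] := hy _ (fracI_in Qq).
rewrite mulrC -uE; apply: fracI_in; apply: contrapT => nPu.
have [M hM PsubM] := maximal_exists PI P1.
have hMp := maximal_prime hM.
have [m Mm nPm] : exists2 m, M m & ~ P m.
  by apply: maximal_notin => // E; apply: nmP; rewrite E.
have nPum : ~ P (u * m) by move=> /PM [].
(* If y q = u with u outside P, then u m is outside P too, so it divides q in
   R_M with a quotient r in Q; then t q = u m r gives t = m (y r) in M. *)
have [t [r [nMt [E|E]]]] := prufer_compare q (u * m) hR hMp.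
  have Qr : Q r.
    by apply: (primary_to_cancel hQ _ nPum); rewrite mulrC -E; apply: idealMl.
  have [z _ zE] := hy _ (fracI_in Qr).
  have u0 : u != 0 by apply: contra_notN nPu => /eqP ->; case: PI.
  apply: nMt; suff -> : t = m * z by apply: idealMr => //; case: hMp.
  apply: (mulfI u0); apply/eqP; rewrite -tofrac_eq; apply/eqP.
  transitivity (y * (t * q)%:F); first by rewrite !tofracM uE; ring.
  by rewrite E !tofracM zE; ring.
have /PM [/PsubM //|//] : P (t * (u * m)).
by rewrite E; apply: idealMr => //; apply: primary_sub hQ _ Qq.
Qed.

(** An m in M outside P divides every p in P inside R_M, with quotient in P; the
    denominator t of the quotient is removed using t R + M = R. *)
Lemma prime_mul_maximal (R : idomainType) (P M : set R) : prufer R ->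
  prime_ideal P -> maximal_ideal M -> P `<=` M -> P <> M -> P `<=` mulI P M.
Proof.
move=> hR [PI P1 PM] hM PsubM neP p Pp; have [MI _ _] := hM.
have [m Mm nPm] := maximal_notin hM PI P1 neP.
have [t [r [nMt [E|E]]]] := prufer_compare p m hR (maximal_prime hM).
  have Pr : P r by have /PM [] : P (m * r) by rewrite -E; apply: idealMl.
  have [a [m' [Mm' E1]]] := maximal_comax hM nMt.
  have -> : p = (a * r) * m + p * m'.
    rewrite -[p in LHS]mulr1 E1 mulrDr; congr (_ + _).
    by transitivity (a * (t * p)); [ring | rewrite E; ring].
  by apply: mulID; apply: mulIM => //; apply: idealMl.
have /PM [/PsubM //|//] : P (t * m).
by rewrite E; apply: idealMr.
Qed.

Lemma prime_mul_maxprod (R : idomainType) (P : set R) n (M : 'I_n -> set R) :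
  prufer R -> prime_ideal P ->
  (forall i, [/\ maximal_ideal (M i), P `<=` M i & P <> M i]) ->
  P `<=` mulI P (maxprod n M).
Proof.
move=> hR hP; have [PI _ _] := hP; elim: n M => [|n IH] M hM p Pp.
  by rewrite big_ord0 -[p]mulr1; apply: mulIM.
rewrite big_ord_recl; set S := (\big[_/_]_(i < n) _).
have [hM0 PM0 neM0] := hM ord0.
have hZ x y : P x -> S y -> mulI P (mulI (M ord0) S) (x * y).
  move=> Px Sy; have := prime_mul_maximal hR hP hM0 PM0 neM0 Px.
  pose Z := [set x | mulI P (mulI (M ord0) S) (x * y)].
  move: x {Px}; apply: (@mulI_ind _ _ _ Z); rewrite /Z /=.
  - by rewrite mul0r; apply: mulI0.
  - by move=> u v Zu Zv; rewrite mulrDl; apply: mulID.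
  - by move=> x m Px Mm; rewrite -mulrA; apply: mulIM => //; apply: mulIM.
have PSp : mulI P S p := IH (fun i => M (lift ord0 i)) (fun=> hM _) p Pp.
exact: (mulI_subideal (mulI_ideal _ PI) hZ PSp).
Qed.

(** Locally at a maximal N above P, if x is not in R_N then x = t / c with t
    outside N.  Such a c is outside P, because x Q inside Q would otherwise let
    one descend through the powers of c, down to 1 in Q.  Hence c divides p in
    R_N.  At other maximal ideals, an element of Q serves as a denominator of
    x. *)
Lemma primary_stabilizer (R : idomainType) (P Q : set R) x p :
  prufer R -> prime_ideal P -> primary_to P Q ->
  (forall q, Q q -> fracI Q (x * q%:F)) -> P p ->
  range (@tofrac R) (x * p%:F).
Proof.
move=> hR hP hQ xQ Pp; have [PI P1 PM] := hP; have [[QI Q1 _] radQ] := hQ.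
apply: range_tofrac_local => N hN; have hNp := maximal_prime hN.
have [PN|/nonsubset [s [Ps nNs]]] := EM (P `<=` N); last first.
  have [k Qk] : radical Q s by rewrite radQ.
  exists (s ^+ k); first by move=> /(prime_exp hNp).
  rewrite mulrAC; apply: range_tofracM.
  by have [r _ <-] := xQ _ Qk; exists r.
have [a [b [b0 xE]]] := fracP x.
have bF : b%:F != 0 by rewrite tofrac_eq0.
have [t [c [nNt [E|E]]]] := prufer_compare a b hR hNp.
  exists t => //; rewrite mulrAC; apply: range_tofracM.
  exists c => //.
    by rewrite xE mulrAC -tofracM [a * t]mulrC E tofracM mulrC mulKf.
have xc : x * c%:F = t%:F by rewrite xE mulrAC -tofracM -E tofracM mulfK.
have nPt : ~ P t by move=> /PN.
have nPc : ~ P c.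
  (* As x c = t is outside P, x c^(n+1) = t c^n in Q gives c^n in Q. *)
  rewrite -radQ => -[n]; elim: n => [|n IH]; first by rewrite expr0.
  move=> /xQ; rewrite exprS tofracM mulrA xc -tofracM => /fracIE.
  by rewrite mulrC => /(primary_to_cancel hQ) /(_ nPt).
have [t' [d [nNt' [E'|E']]]] := prufer_compare p c hR hNp.
  exists t' => //; exists (t * d) => //.
  by rewrite -mulrA -tofracM [p * t']mulrC E' !tofracM mulrA xc.
have /PM [/PN //|//] : P (t' * c).
by rewrite E'; apply: idealMr.
Qed.

Lemma weak_factorization_trace (R : idomainType) :
  prufer R -> weak_factorization R -> weak_trace_primary R.
Proof.
move=> hR hW P Q hP nzP nmP hQ; have [PI P1 PM] := hP.
have [[QI Q1 _] radQ] := hQ.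
have nzQ : nonzero Q by move=> Q0; apply: nzP; rewrite -radQ Q0 radical0.
set T := mulI _ _; pose J : set R := [set r | T r%:F].
have TP : T `<=` fracI P.
  apply: mulI_ind => [|u v|_ y [q Qq <-] hy]; first exact: fracI0.
    exact: fracI_add.
  exact: primary_trace_sub hQ Qq hy.
have JT : fracI J = T.
  apply/seteqP; split; first by move=> _ [r Jr <-].
  by move=> z Tz; have [r _ rE] := TP z Tz; exists r => //; rewrite /J /= rE.
have JI : is_ideal J.
  split=> [|a u v Ju Jv]; rewrite /J /= ?tofrac0; first exact: mulI0.
  rewrite tofracD tofracM; apply: mulID => //; apply: mulI_scale Ju.
  by move=> _ [q Qq <-]; rewrite -tofracM; apply: fracI_in; apply: idealMl.
have QJ : Q `<=` J.
  move=> q Qq; rewrite /J /= -[q%:F]mulr1; apply: mulIM; first exact: fracI_in.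
  exact: invI_fracI1.
have nzJ : nonzero J.
  have [q Qq q0] := nonzeroP QI nzQ.
  by move=> J0; apply: q0; have := QJ q Qq; rewrite J0.
apply/seteqP; split=> // _ [p Pp <-].
have [n [M [hM E]]] := hW J JI nzJ.
have JM i : J `<=` M i.
  have [MI _ _] := hM i.
  suff sub : fracI J `<=` fracI (M i).
    by move=> r Jr; exact: (fracIE (sub _ (fracI_in Jr))).
  rewrite E; apply: mulI_ind => [|u v|_ _ /vI_range [a _ <-] [s Ms <-]].
  - exact: fracI0.
  - exact: fracI_add.
  - rewrite -tofracM; apply: fracI_in; apply: idealMl => //.
    exact: (@maxprod_sub _ _ _ hM i _ Ms).
have PMi i : P `<=` M i.
  move=> s; rewrite -radQ => -[k /QJ /(JM i)].
  exact: (prime_exp (maximal_prime (hM i))).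
have PJv r : P r -> vI (fracI J) r%:F.
  (* For x in J^-1 and q in Q, x q Q^-1 is inside R, so x q is in Q^v = Q. *)
  move=> Pr x hx; rewrite mulrC.
  apply: (primary_stabilizer hR hP hQ) => // q Qq.
  rewrite (weak_factorization_divisorial hW hP nmP hQ nzQ) => y hy.
  by rewrite -mulrA; apply: hx; rewrite JT; apply: mulIM => //; apply: fracI_in.
have Pprod : P `<=` mulI P (maxprod n M).
  apply: prime_mul_maxprod => // i; split=> // PMeq.
  by apply: nmP; rewrite PMeq.
suff : J p by [].
apply: (mulI_subideal JI _ (Pprod _ Pp)) => r s /PJv vr Ms.
exact: weak_factorization_mem E vr Ms.
Qed.

(** The ideal J is the conductor into R of a y in Q^-1 that does not multiply Q
    into Q; such a y exists because the trace Q Q^-1 = P is not inside Q. *)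
Lemma branched_radical_fin_gen (R : idomainType) (P : set R) :
  prufer R -> weak_trace_primary R -> prime_ideal P -> ~ maximal_ideal P ->
  branched P -> exists J : set R, is_ideal J /\ fin_gen J /\ P = radical J.
Proof.
move=> hR hT hP nmP [Q [hQ QP]]; have [PI P1 PM] := hP.
have [[QI Q1 _] radQ] := hQ.
have nzP : nonzero P.
  move=> P0; apply: QP; rewrite P0; apply/seteqP; split=> x /=.
    by move/(primary_sub hQ); rewrite P0.
  by move=> ->; case: QI.
have [q [y [Qq hy nQqy]]] :
    exists q y, [/\ Q q, invI (fracI Q) y & ~ fracI Q (q%:F * y)].
  apply: contrapT => no; apply: QP; apply/seteqP.
  split; first exact: primary_sub.
  suff sub : fracI P `<=` fracI Q.
    by move=> p Pp; exact: (fracIE (sub _ (fracI_in Pp))).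
  rewrite -(hT P Q hP nzP nmP hQ).
  apply: mulI_ind => [|u v|_ y [q Qq <-] hy].
  - exact: fracI0.
  - exact: fracI_add.
  by apply: contrapT => nQ; apply: no; exists q, y.
have [u _ uE] := hy _ (fracI_in Qq).
have nQu : ~ Q u by move=> Qu; apply: nQqy; rewrite mulrC -uE; apply: fracI_in.
exists [set r | range (@tofrac R) (y * r%:F)]; split.
  exact: range_tofrac_ideal.
split; first exact: prufer_conductor.
apply/seteqP; split=> x.
  by rewrite -radQ => -[k Qk]; exists k; apply: hy; apply: fracI_in.
move=> [k [c _ cE]]; apply: (prime_exp hP (n := k)); apply: contrapT => nPr.
(* If r = x^k is outside P and y r = c, then u r = y q r = c q is in Q. *)
apply: nQu; apply: (primary_to_cancel hQ _ nPr).
suff -> : u * x ^+ k = c * q by apply: idealMl.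
by apply/eqP; rewrite -tofrac_eq !tofracM uE cE; apply/eqP; ring.
Qed.

Theorem proposition1p7 (R : idomainType)
    (hPrufer : prufer R) (hWFP : weak_factorization R) :
  [/\ (forall P Q : set R, prime_ideal P -> ~ maximal_ideal P ->
         primary_to P Q -> nonzero Q -> divisorial Q) /\
      (forall P : set R, prime_ideal P -> ~ maximal_ideal P ->
         nonzero P -> divisorial P),
      forall M I : set R, maximal_ideal M -> idempotent_ideal M ->
        primary_to M I -> nonzero I -> ~ divisorial I ->
        fracI I = mulI (vI (fracI I)) (fracI M),
      forall M : set R, maximal_ideal M -> branched M -> idempotent_ideal M ->
        sharp M,
      weak_trace_primary R &
      forall P : set R, prime_ideal P -> ~ maximal_ideal P -> branched P ->
        exists J : set R, is_ideal J /\ fin_gen J /\ P = radical J].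
Proof.
have trace := weak_factorization_trace hPrufer hWFP.
split=> //.
- split=> [P Q|P] hP nmP; first exact: weak_factorization_divisorial.
  exact/(weak_factorization_divisorial hWFP hP nmP)/prime_primary.
- by move=> M I; apply: weak_factorization_idempotent.
- by move=> M hM bM MM; apply: branched_idempotent_sharp.
- by move=> P; apply: branched_radical_fin_gen.
Qed.
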